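(* In $\operatorname{ZF}$, $\operatorname{RC}_5$ implies $\operatorname{LOC}_5^-$.
   Context: For a set $Y$, $[Y]^n=\{z\subseteq Y\mid |z|=n\}$. $\operatorname{RC}_n$: every infinite set $X$ has an infinite subset $Y\subseteq X$ such that $[Y]^n$ has a choice function. $\operatorname{LOC}_n^-$: every infinite, linearly orderable family $\mathcal{F}$ of sets of size $n$ has an infinite subset $\mathcal{G}\subseteq\mathcal{F}$ with a choice function. *)

(* Defs.v *)
Record set_structure : Type := SetStructure {
  carrier :> Type;
  mem : carrier -> carrier -> Prop
}.

Arguments mem {_} _ _.

Declare Scope zf_scope.
Delimit Scope zf_scope with zf.
Notation "x ∈ y" := (mem x y) (at level 70, no associativity) : zf_scope.
Open Scope zf_scope.

(* First-order formulas in the language {∈, =}, with de Bruijn indices: under a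
   quantifier, index 0 is the newly bound variable. They are used only to state
   the Separation and Replacement schemata: letting these range over arbitrary
   predicates of the ambient logic instead would give second-order ZF, in which
   choice in the metatheory is inherited by the model. *)
Inductive formula : Type :=
| fMem (i j : nat)
| fEq (i j : nat)
| fBot
| fImp (p q : formula)
| fAnd (p q : formula)
| fOr (p q : formula)
| fAll (p : formula)
| fEx (p : formula).

Definition env_cons {A : Type} (a : A) (rho : nat -> A) (i : nat) : A :=
  match i with O => a | S j => rho j end.

Fixpoint sat {M : set_structure} (rho : nat -> M) (p : formula) : Prop :=
  match p with
  | fMem i j => rho i ∈ rho j
  | fEq i j => rho i = rho j
  | fBot => False
  | fImp p q => sat rho p -> sat rho q
  | fAnd p q => sat rho p /\ sat rho q
  | fOr p q => sat rho p \/ sat rho q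
  | fAll p => forall a : M, sat (env_cons a rho) p
  | fEx p => exists a : M, sat (env_cons a rho) p
  end.

Section SetTheory.

Context {M : set_structure}.
Implicit Types a b c f k p r s x y z F G S X Y : M.

Definition subset x y : Prop := forall z, z ∈ x -> z ∈ y.

Definition is_empty x : Prop := forall z, ~ z ∈ x.

(* c = {a, b} *)
Definition is_upair c a b : Prop := forall z, z ∈ c <-> z = a \/ z = b.

(* s = x ∪ {x} *)
Definition is_succ s x : Prop := forall z, z ∈ s <-> z ∈ x \/ z = x.

(* p = {{x}, {x, y}}, the Kuratowski pair *)
Definition is_opair p x y : Prop :=
  exists a b, is_upair a x x /\ is_upair b x y /\ is_upair p a b.

Definition opair_in x y r : Prop := exists p, is_opair p x y /\ p ∈ r.

(* f is a function with domain X and values in Y *)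
Definition is_function f X Y : Prop :=
  (forall p, p ∈ f -> exists x y, x ∈ X /\ y ∈ Y /\ is_opair p x y) /\
  (forall x, x ∈ X -> exists! y, opair_in x y f).

Definition is_bijection f X Y : Prop :=
  is_function f X Y /\
  (forall y, y ∈ Y -> exists! x, opair_in x y f).

Definition equinumerous X Y : Prop := exists f, is_bijection f X Y.

Definition inductive x : Prop :=
  (exists e, is_empty e /\ e ∈ x) /\
  (forall y, y ∈ x -> exists s, is_succ s y /\ s ∈ x).

(* k ∈ ω, in the sense of the structure; in a structure with non-standard
   natural numbers this is weaker than being one of the [is_numeral n] below. *)
Definition is_natural k : Prop := forall x, inductive x -> k ∈ x.

Definition finite X : Prop := exists k, is_natural k /\ equinumerous X k.

Definition infinite X : Prop := ~ finite X.

(* k is the von Neumann numeral of the metatheoretic natural number n. *)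
Fixpoint is_numeral (n : nat) (k : M) : Prop :=
  match n with
  | O => is_empty k
  | Datatypes.S m => exists j : M, is_numeral m j /\ is_succ k j
  end.

(* |z| = n *)
Definition has_size (n : nat) z : Prop :=
  exists k, is_numeral n k /\ equinumerous z k.

(* S = [Y]^n *)
Definition is_nsubsets (n : nat) Y S : Prop :=
  forall z, z ∈ S <-> subset z Y /\ has_size n z.

Definition is_union U F : Prop :=
  forall z, z ∈ U <-> exists y, y ∈ F /\ z ∈ y.

(* f : F -> ⋃F with f(z) ∈ z for all z ∈ F *)
Definition is_choice_function f F : Prop :=
  (exists U, is_union U F /\ is_function f F U) /\
  (forall z y, z ∈ F -> opair_in z y f -> y ∈ z).

Definition has_choice_function F : Prop := exists f, is_choice_function f F.

(* r is a (reflexive) linear order on X, as a set of ordered pairs *)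
Definition is_linear_order r X : Prop :=
  (forall p, p ∈ r -> exists x y, x ∈ X /\ y ∈ X /\ is_opair p x y) /\
  (forall x y, x ∈ X -> y ∈ X -> opair_in x y r \/ opair_in y x r) /\
  (forall x y, opair_in x y r -> opair_in y x r -> x = y) /\
  (forall x y z, opair_in x y r -> opair_in y z r -> opair_in x z r).

Definition linearly_orderable X : Prop := exists r, is_linear_order r X.

End SetTheory.

Record ZF (M : set_structure) : Prop := {
  zf_extensionality :
    forall x y : M, (forall z : M, z ∈ x <-> z ∈ y) -> x = y;
  zf_foundation :
    forall x : M, (exists y : M, y ∈ x) ->
      exists y : M, y ∈ x /\ forall z : M, ~ (z ∈ y /\ z ∈ x);
  zf_pairing :
    forall a b : M, exists c : M, is_upair c a b;
  zf_union :
    forall F : M, exists U : M, is_union U F;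
  zf_powerset :
    forall x : M, exists P : M, forall z : M, z ∈ P <-> subset z x;
  zf_infinity :
    exists x : M, inductive x;
  zf_separation :
    forall (phi : formula) (rho : nat -> M) (x : M),
      exists y : M, forall z : M,
        z ∈ y <-> z ∈ x /\ sat (env_cons z rho) phi;
  (* In phi, index 0 is the value and index 1 the argument. *)
  zf_replacement :
    forall (phi : formula) (rho : nat -> M) (A : M),
      (forall x : M, x ∈ A ->
         exists! y : M, sat (env_cons y (env_cons x rho)) phi) ->
      exists B : M, forall y : M,
        y ∈ B <-> exists x : M, x ∈ A /\ sat (env_cons y (env_cons x rho)) phi
}.

Definition RC (n : nat) (M : set_structure) : Prop :=
  forall X : M, infinite X ->
    exists Y : M, subset Y X /\ infinite Y /\
      exists S : M, is_nsubsets n Y S /\ has_choice_function S.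

Definition LOC_minus (n : nat) (M : set_structure) : Prop :=
  forall F : M, infinite F -> linearly_orderable F ->
    (forall z : M, z ∈ F -> has_size n z) ->
    exists G : M, subset G F /\ infinite G /\ has_choice_function G.

(* Main.v *)
(* Suppose an infinite linearly ordered family F of 5-element sets has no
   infinite subfamily with a choice function. Then a definable property of the
   elements x of z ∈ F cannot single out one point, or all but one, for
   infinitely many z. RC_5 applied to the disjoint union of F therefore yields,
   for infinitely many z, a splitting z = A_z ∪ B_z with |A_z| = 2, |B_z| = 3
   (if Y contains all of z, the choice function on [Y]^5 picks a point of z).
   From then on definable properties of points of A_z, of B_z and of A_z × B_z
   are constant for all but finitely many z.

   RC_5 applied to the disjoint union of the A_z × B_z then gives choices from
   all sets {z} × {a} × B_z ∪ {w} × A_w × {b} with z ≠ w. For fixed z and all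
   but finitely many w, homogeneity over w forces the choice to be (z, a, h(a))
   with h : A_z -> B_z independent of b; write D z w for this. For fixed w, by
   homogeneity over z, D z w holds for only finitely many z. Each z thus has a
   finite exceptional set {w | ~ D z w}, and each w is exceptional for almost
   all z. The maxima of these sets in the linear order essentially form a set
   of order type ω, along which some w with D z w can be selected definably
   from z; the function h then breaks the homogeneity of A_z × B_z.

   Sets exist in the model only for first-order definable properties, so
   definability of every property used is tracked by the predicate Dfn. *)

Require Import Defs.
From Stdlib Require Import Classical ClassicalEpsilon List Arith.

(** * Definability with parameters *)

Fixpoint rename (xi : nat -> nat) (p : formula) : formula :=
  let up := fun i => match i with O => O | S j => S (xi j) end in
  match p with
  | fMem i j => fMem (xi i) (xi j)
  | fEq i j => fEq (xi i) (xi j)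
  | fBot => fBot
  | fImp p q => fImp (rename xi p) (rename xi q)
  | fAnd p q => fAnd (rename xi p) (rename xi q)
  | fOr p q => fOr (rename xi p) (rename xi q)
  | fAll p => fAll (rename up p)
  | fEx p => fEx (rename up p)
  end.

Lemma sat_ext {M : set_structure} (p : formula) : forall rho sigma : nat -> M,
  (forall i, rho i = sigma i) -> sat rho p <-> sat sigma p.
Proof.
  induction p as [i j|i j| |p IHp q IHq|p IHp q IHq|p IHp q IHq|p IHp|p IHp];
    intros rho sigma H; simpl.
  1, 2: now rewrite !H.
  - tauto.
  - rewrite (IHp _ _ H), (IHq _ _ H); tauto.
  - rewrite (IHp _ _ H), (IHq _ _ H); tauto.
  - rewrite (IHp _ _ H), (IHq _ _ H); tauto.
  - assert (E : forall a, sat (env_cons a rho) p <-> sat (env_cons a sigma) p)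
      by (intros a; apply IHp; intros [|i]; simpl; auto).
    split; intros K a; apply E, K.
  - assert (E : forall a, sat (env_cons a rho) p <-> sat (env_cons a sigma) p)
      by (intros a; apply IHp; intros [|i]; simpl; auto).
    split; intros [a K]; exists a; apply E, K.
Qed.

Lemma sat_rename {M : set_structure} (p : formula) : forall (xi : nat -> nat) (rho : nat -> M),
  sat rho (rename xi p) <-> sat (fun i => rho (xi i)) p.
Proof.
  induction p as [i j|i j| |p IHp q IHq|p IHp q IHq|p IHp q IHq|p IHp|p IHp];
    intros xi rho; simpl; try tauto.
  1, 2, 3: rewrite IHp, IHq; tauto.
  - assert (E : forall a,
      sat (env_cons a rho)
        (rename (fun i => match i with O => O | S j => S (xi j) end) p) <->
      sat (env_cons a (fun i => rho (xi i))) p)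
      by (intros a; rewrite IHp; apply sat_ext; intros [|i]; reflexivity).
    split; intros K a; apply E, K.
  - assert (E : forall a,
      sat (env_cons a rho)
        (rename (fun i => match i with O => O | S j => S (xi j) end) p) <->
      sat (env_cons a (fun i => rho (xi i))) p)
      by (intros a; rewrite IHp; apply sat_ext; intros [|i]; reflexivity).
    split; intros [a K]; exists a; apply E, K.
Qed.

Section Definability.

Context {M : set_structure}.

Definition source (rho : nat -> M) (s : nat + M) : M :=
  match s with inl i => rho i | inr c => c end.

(* Every free variable of the formula is bound either to an entry of the
   environment or to a parameter. *)
Definition Dfn (P : (nat -> M) -> Prop) : Prop :=
  exists (phi : formula) (s : nat -> nat + M),
    forall rho, P rho <-> sat (fun i => source rho (s i)) phi.

(** The language has no function symbols, so a term counts as definable through its graph. *)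
Definition Term (t : (nat -> M) -> M) : Prop :=
  Dfn (fun rho => rho 0 = t (fun i => rho (S i))).

Definition Def1 (R : M -> Prop) : Prop := Dfn (fun rho => R (rho 0)).

Definition Def2 (R : M -> M -> Prop) : Prop :=
  Dfn (fun rho => R (rho 0) (rho 1)).

Definition Def3 (R : M -> M -> M -> Prop) : Prop :=
  Dfn (fun rho => R (rho 0) (rho 1) (rho 2)).

Lemma Dfn_ext (P Q : (nat -> M) -> Prop) :
  (forall rho, Q rho <-> P rho) -> Dfn P -> Dfn Q.
Proof.
  intros H (phi & s & K); exists phi, s; intros rho; rewrite H; apply K.
Qed.

Lemma Dfn_binary (P Q : (nat -> M) -> Prop)
  (op : Prop -> Prop -> Prop) (fop : formula -> formula -> formula) :
  (forall rho p q, @sat M rho (fop p q) <-> op (sat rho p) (sat rho q)) ->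
  (forall a b c d : Prop, (a <-> b) -> (c <-> d) -> (op a c <-> op b d)) ->
  Dfn P -> Dfn Q -> Dfn (fun rho => op (P rho) (Q rho)).
Proof.
  intros Hf Hop (phi & s & K) (psi & t & L).
  (* The two formulas carry separate assignments [s] and [t]. Even indices are reserved for the
     first and odd ones for the second, so that a single assignment serves both. *)
  exists (fop (rename (fun i => 2 * i) phi) (rename (fun i => S (2 * i)) psi)),
    (fun i => if Nat.even i then s (Nat.div2 i) else t (Nat.div2 i)).
  intros rho; rewrite Hf; apply Hop; rewrite sat_rename.
  - rewrite K; apply sat_ext; intros i.
    now rewrite Nat.even_even, Nat.div2_double.
  - rewrite L; apply sat_ext; intros i.
    rewrite Nat.even_succ, Nat.odd_even, Nat.div2_succ_double; reflexivity.
Qed.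

Lemma Dfn_and (P Q : (nat -> M) -> Prop) :
  Dfn P -> Dfn Q -> Dfn (fun rho => P rho /\ Q rho).
Proof. apply Dfn_binary with (fop := fAnd); simpl; tauto. Qed.

Lemma Dfn_or (P Q : (nat -> M) -> Prop) :
  Dfn P -> Dfn Q -> Dfn (fun rho => P rho \/ Q rho).
Proof. apply Dfn_binary with (fop := fOr); simpl; tauto. Qed.

Lemma Dfn_imp (P Q : (nat -> M) -> Prop) :
  Dfn P -> Dfn Q -> Dfn (fun rho => P rho -> Q rho).
Proof.
  apply (Dfn_binary P Q (fun p q => p -> q)) with (fop := fImp); simpl; tauto.
Qed.

Lemma Dfn_false : Dfn (fun _ => False).
Proof. exists fBot, (fun i => inl i); simpl; tauto. Qed.

Lemma Dfn_iff (P Q : (nat -> M) -> Prop) :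
  Dfn P -> Dfn Q -> Dfn (fun rho => P rho <-> Q rho).
Proof. intros HP HQ; apply Dfn_and; apply Dfn_imp; assumption. Qed.

Lemma Dfn_not (P : (nat -> M) -> Prop) : Dfn P -> Dfn (fun rho => ~ P rho).
Proof. intros HP; apply Dfn_imp; [assumption | apply Dfn_false]. Qed.

Lemma Dfn_rename (P : (nat -> M) -> Prop) (xi : nat -> nat) :
  Dfn P -> Dfn (fun rho => P (fun i => rho (xi i))).
Proof.
  intros (phi & s & K).
  exists phi, (fun i => match s i with inl j => inl (xi j) | inr c => inr c end).
  intros rho; rewrite K; apply sat_ext; intros i; destruct (s i); reflexivity.
Qed.

(** Prepares a formula for quantification: several indices may point to [inl 0], and all of them
    have to be merged into the de Bruijn index 0 while the others move up by one. *)
Lemma sat_bind (phi : formula) (s : nat -> nat + M) :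
  exists (psi : formula) (t : nat -> nat + M), forall a rho,
    sat (fun i => source (env_cons a rho) (s i)) phi <->
    sat (env_cons a (fun i => source rho (t i))) psi.
Proof.
  exists (rename (fun i => match s i with inl O => O | _ => S i end) phi),
    (* The value at [inl O] is a mere default: such indices have been renamed to 0 and never reach
       [t]. *)
    (fun i => match s i with inl (S j) => inl j | inl O => inl O | inr c => inr c end).
  intros a rho; rewrite sat_rename; apply sat_ext; intros i.
  destruct (s i) as [[|j]|c] eqn:E; simpl; rewrite ?E; reflexivity.
Qed.

Lemma Dfn_all (P : M -> (nat -> M) -> Prop) :
  Dfn (fun rho => P (rho 0) (fun i => rho (S i))) ->
  Dfn (fun rho => forall a, P a rho).
Proof.
  intros (phi & s & K); destruct (sat_bind phi s) as (psi & t & L).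
  exists (fAll psi), t; intros rho; simpl.
  split; intros H a; [apply L, (K (env_cons a rho)), H|].
  apply (K (env_cons a rho)), L, H.
Qed.

Lemma Dfn_ex (P : M -> (nat -> M) -> Prop) :
  Dfn (fun rho => P (rho 0) (fun i => rho (S i))) ->
  Dfn (fun rho => exists a, P a rho).
Proof.
  intros (phi & s & K); destruct (sat_bind phi s) as (psi & t & L).
  exists (fEx psi), t; intros rho; simpl.
  split; intros [a H]; exists a; [apply L, (K (env_cons a rho)), H|].
  apply (K (env_cons a rho)), L, H.
Qed.

Lemma Term_var (i : nat) : Term (fun rho => rho i).
Proof.
  exists (fEq 0 1), (fun k => match k with O => inl O | _ => inl (S i) end).
  intros rho; simpl; tauto.
Qed.

Lemma Term_const (c : M) : Term (fun _ => c).
Proof.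
  exists (fEq 0 1), (fun k => match k with O => inl O | _ => inr c end).
  intros rho; simpl; tauto.
Qed.

Lemma Term_shift (t : (nat -> M) -> M) :
  Term t -> Term (fun rho => t (fun i => rho (S i))).
Proof.
  intros H.
  apply (Dfn_rename _ (fun i => match i with O => O | S j => S (S j) end)) in H.
  exact H.
Qed.

(** Substitution of a term becomes an existential quantifier over its value, since only the graph of
    the term is available. *)
Lemma Dfn_inst (P : M -> (nat -> M) -> Prop) (t : (nat -> M) -> M) :
  Term t -> Dfn (fun rho => P (rho 0) (fun i => rho (S i))) ->
  Dfn (fun rho => P (t rho) rho).
Proof.
  intros Ht HP.
  apply Dfn_ext with (fun rho => exists a, a = t rho /\ P a rho).
  - intros rho; split; [intros H; exists (t rho); auto | intros (a & -> & H); auto].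
  - apply (Dfn_ex (fun a rho => a = t rho /\ P a rho)).
    apply Dfn_and; assumption.
Qed.

Lemma Dfn_app1 (R : M -> Prop) (t : (nat -> M) -> M) :
  Def1 R -> Term t -> Dfn (fun rho => R (t rho)).
Proof. intros HR Ht; apply (Dfn_inst (fun a _ => R a)); assumption. Qed.

Lemma Dfn_app2 (R : M -> M -> Prop) (t u : (nat -> M) -> M) :
  Def2 R -> Term t -> Term u -> Dfn (fun rho => R (t rho) (u rho)).
Proof.
  intros HR Ht Hu; apply (Dfn_inst (fun a rho => R a (u rho))); auto.
  apply (Dfn_inst (fun b rho => R (rho 0) b) (fun rho => u (fun i => rho (S i)))).
  - now apply Term_shift.
  - apply (Dfn_rename _ (fun i => match i with O => 1 | _ => 0 end)) in HR; exact HR.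
Qed.

Lemma Dfn_app3 (R : M -> M -> M -> Prop) (t u v : (nat -> M) -> M) :
  Def3 R -> Term t -> Term u -> Term v ->
  Dfn (fun rho => R (t rho) (u rho) (v rho)).
Proof.
  intros HR Ht Hu Hv; apply (Dfn_inst (fun a rho => R a (u rho) (v rho))); auto.
  apply (Dfn_inst (fun b rho => R (rho 0) b (v (fun i => rho (S i))))
           (fun rho => u (fun i => rho (S i)))); [now apply Term_shift|].
  apply (Dfn_inst (fun c rho => R (rho 1) (rho 0) c)
           (fun rho => v (fun i => rho (S (S i))))).
  - apply (Term_shift (fun rho => v (fun i => rho (S i)))), Term_shift, Hv.
  - apply (Dfn_rename _ (fun i => match i with O => 2 | 1 => 1 | _ => 0 end)) in HR.
    exact HR.
Qed.

Lemma Def2_mem : Def2 (fun x y : M => x ∈ y).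
Proof. exists (fMem 0 1), (fun i => inl i); simpl; tauto. Qed.

Lemma Def2_eq : Def2 (fun x y : M => x = y).
Proof. exists (fEq 0 1), (fun i => inl i); simpl; tauto. Qed.

Lemma Dfn_mem (t u : (nat -> M) -> M) :
  Term t -> Term u -> Dfn (fun rho => t rho ∈ u rho).
Proof. apply (Dfn_app2 _ t u Def2_mem). Qed.

Lemma Dfn_eq (t u : (nat -> M) -> M) :
  Term t -> Term u -> Dfn (fun rho => t rho = u rho).
Proof. apply (Dfn_app2 _ t u Def2_eq). Qed.

End Definability.

(** * Automated definability proofs *)

Ltac dfn_term := first [apply Term_var | apply Term_const].

Ltac dfn_unfold := unfold Def1, Def2, Def3, unique; cbv beta.

(** Recursion on the shape of the predicate. [term] closes the goals about terms, and [unf] unfolds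
    defined notions once no connective and no definability hypothesis applies. *)
Ltac dfn_with unf term :=
  dfn_unfold;
  let rec go :=
    lazymatch goal with
    | |- Term _ => term
    | |- Dfn (fun rho => _ /\ _) => apply Dfn_and; go
    | |- Dfn (fun rho => _ \/ _) => apply Dfn_or; go
    | |- Dfn (fun rho => ~ _) => apply Dfn_not; go
    | |- Dfn (fun rho => _ <-> _) => apply Dfn_iff; go
    | |- Dfn (fun rho => False) => apply Dfn_false
    | |- Dfn (fun rho => exists a, _) => apply Dfn_ex; cbv beta; go
    | |- Dfn (fun rho => mem _ _) => apply Dfn_mem; go
    | |- Dfn (fun rho => _ = _) => apply Dfn_eq; go
    | |- _ =>
      first
        [ apply Dfn_imp; [go | go]
        | apply Dfn_all; cbv beta; go
        | match goal with
          | H : Def1 ?R |- Dfn (fun rho => ?R _) => apply (Dfn_app1 R _ H); go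
          | H : Def2 ?R |- Dfn (fun rho => ?R _ _) => apply (Dfn_app2 R _ _ H); go
          | H : Def3 ?R |- Dfn (fun rho => ?R _ _ _) => apply (Dfn_app3 R _ _ _ H); go
          end
        | progress unf; unfold unique; cbv beta; go ]
    end in
  go.

Section Model.

Context {M : set_structure} (hZF : ZF M).
Implicit Types a b c e f k p r s u v w x y z F G I J S X Y : M.

(** * Elementary set formation *)

Lemma separation (P : M -> Prop) x :
  Def1 P -> exists y, forall z, z ∈ y <-> z ∈ x /\ P z.
Proof.
  intros (phi & s & K); destruct (sat_bind phi s) as (psi & t & L).
  (* The constant environment [x] is an arbitrary filler: [P] looks only at index 0. *)
  destruct (zf_separation M hZF psi (fun i => source (fun _ => x) (t i)) x) as [y H].
  exists y; intros z; rewrite H.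
  rewrite <- (L z (fun _ => x)), <- (K (env_cons z (fun _ => x))); reflexivity.
Qed.

Lemma extensionality x y : (forall z, z ∈ x <-> z ∈ y) -> x = y.
Proof. apply (zf_extensionality M hZF). Qed.

Lemma empty_exists : exists e, is_empty e.
Proof.
  destruct (zf_infinity M hZF) as [x [(e & He & _) _]]; exists e; exact He.
Qed.

Lemma cup_exists x y : exists z, forall a, a ∈ z <-> a ∈ x \/ a ∈ y.
Proof.
  destruct (zf_pairing M hZF x y) as [c Hc], (zf_union M hZF c) as [z Hz].
  exists z; intros a; rewrite (Hz a); split.
  - intros (u & Hu & Ha); apply Hc in Hu as [-> | ->]; auto.
  - intros [H | H]; [exists x | exists y]; split; auto; apply Hc; auto.
Qed.

Lemma adjoin_exists x a : exists y, forall z, z ∈ y <-> z ∈ x \/ z = a.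
Proof.
  destruct (zf_pairing M hZF a a) as [c Hc], (cup_exists x c) as [y Hy].
  exists y; intros z; rewrite (Hy z), (Hc z); tauto.
Qed.

Lemma succ_exists x : exists s, is_succ s x.
Proof. apply adjoin_exists. Qed.

Lemma notin_self x : ~ x ∈ x.
Proof.
  intros H; destruct (zf_pairing M hZF x x) as [c Hc].
  destruct (zf_foundation M hZF c) as (y & Hy & K).
  - exists x; apply Hc; auto.
  - apply Hc in Hy; assert (y = x) as -> by tauto.
    apply (K x); split; [exact H | apply Hc; auto].
Qed.

Lemma opair_exists x y : exists p, is_opair p x y.
Proof.
  destruct (zf_pairing M hZF x x) as [a Ha], (zf_pairing M hZF x y) as [b Hb].
  destruct (zf_pairing M hZF a b) as [p Hp].
  exists p, a, b; auto.
Qed.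

(** Description in the metatheory merely names an object that is unique by [opair_iff]. By [Term_op]
    its graph is first-order, so no choice is passed on to the model. *)
Definition op x y : M :=
  proj1_sig (constructive_indefinite_description _ (opair_exists x y)).

Lemma op_spec x y : is_opair (op x y) x y.
Proof. unfold op; apply proj2_sig. Qed.

Lemma opair_iff p x y : is_opair p x y <-> p = op x y.
Proof.
  split; [|intros ->; apply op_spec].
  intros (a & b & Ha & Hb & Hp); destruct (op_spec x y) as (a' & b' & Ha' & Hb' & Hp').
  assert (a = a') as <- by (apply extensionality; intros z; rewrite (Ha z), (Ha' z); tauto).
  assert (b = b') as <- by (apply extensionality; intros z; rewrite (Hb z), (Hb' z); tauto).
  apply extensionality; intros z; rewrite (Hp z), (Hp' z); tauto.
Qed.

Lemma opair_in_iff x y r : opair_in x y r <-> op x y ∈ r.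
Proof.
  split.
  - intros (p & Hp & H); apply opair_iff in Hp; subst; exact H.
  - intros H; exists (op x y); split; [apply op_spec | exact H].
Qed.

Lemma op_inj x y x' y' : op x y = op x' y' -> x = x' /\ y = y'.
Proof.
  intros E; destruct (op_spec x y) as (a & b & Ha & Hb & Hp).
  destruct (op_spec x' y') as (a' & b' & Ha' & Hb' & Hp'); rewrite <- E in Hp'.
  assert (Hx : x = x').
  { assert (Hin : a ∈ op x y) by (apply Hp; auto).
    apply Hp' in Hin as [-> | ->].
    - assert (H : x ∈ a') by (apply Ha; auto). apply Ha' in H; tauto.
    - assert (H : x' ∈ b') by (apply Hb'; auto). apply Ha in H; intuition congruence. }
  subst x'; split; [reflexivity|].
  assert (Haa : a' = a) by (apply extensionality; intros z; rewrite (Ha z), (Ha' z); tauto).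
  subst a'.
  assert (Hin : b ∈ op x y) by (apply Hp; auto).
  assert (Hin' : b' ∈ op x y) by (apply Hp'; auto).
  assert (Hy : y ∈ b) by (apply Hb; auto).
  assert (Hy' : y' ∈ b') by (apply Hb'; auto).
  apply Hp' in Hin; apply Hp in Hin'.
  assert (K : forall z, z ∈ a -> z = x) by (intros z Hz; apply Ha in Hz; tauto).
  destruct Hin as [-> | ->].
  - assert (y = x) as -> by auto.
    destruct Hin' as [-> | ->]; [symmetry; auto|].
    symmetry; auto.
  - apply Hb' in Hy as [-> | ->]; auto.
    apply Hb in Hy'; intuition congruence.
Qed.

Lemma Term_op (t u : (nat -> M) -> M) :
  Term t -> Term u -> Term (fun rho => op (t rho) (u rho)).
Proof.
  intros Ht Hu; unfold Term.
  apply Dfn_ext with (fun rho =>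
    is_opair (rho 0) (t (fun i => rho (S i))) (u (fun i => rho (S i)))).
  - intros rho; symmetry; apply opair_iff.
  - assert (H : Def3 (@is_opair M))
      by (dfn_with ltac:(unfold is_opair, is_upair) dfn_term).
    apply (Dfn_app3 _ _ _ _ H); [apply Term_var | |]; now apply Term_shift.
Qed.

Ltac dfn_op_term :=
  first [apply Term_var | apply Term_op; dfn_op_term | apply Term_const].

(** A Kuratowski pair over x ∪ y lies in the double power set. A superset of the product suffices,
    because Separation cuts out what is needed. *)
Lemma product_cover x y :
  exists z, forall a b, a ∈ x -> b ∈ y -> op a b ∈ z.
Proof.
  destruct (cup_exists x y) as [u Hu], (zf_powerset M hZF u) as [v Hv].
  destruct (zf_powerset M hZF v) as [w Hw].
  exists w; intros a b Ha Hb; apply Hw; intros c Hc; apply Hv; intros d Hd; apply Hu.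
  destruct (op_spec a b) as (s & t & Hs & Ht & Hp).
  apply Hp in Hc as [-> | ->]; [apply Hs in Hd | apply Ht in Hd];
    destruct Hd; subst; auto.
Qed.

(** * Finite sets *)

Lemma equinumerous_of_rel X Y (R : M -> M -> Prop) :
  Def2 R ->
  (forall x, x ∈ X -> exists! y, y ∈ Y /\ R x y) ->
  (forall y, y ∈ Y -> exists! x, x ∈ X /\ R x y) ->
  equinumerous X Y.
Proof.
  intros HR H1 H2; destruct (product_cover X Y) as [c Hc].
  destruct (separation (fun p => exists x y, x ∈ X /\ y ∈ Y /\ p = op x y /\ R x y) c)
    as [f Hf].
  { dfn_with ltac:(fail) dfn_op_term. }
  assert (Hin : forall x y, op x y ∈ f <-> x ∈ X /\ y ∈ Y /\ R x y).
  { intros x y; rewrite Hf; split.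
    - intros (_ & x' & y' & ? & ? & E & ?); apply op_inj in E as [-> ->]; auto.
    - intros (? & ? & ?); split; [now apply Hc | exists x, y; auto]. }
  exists f; split; [split|].
  - intros p Hp; apply Hf in Hp as (_ & x & y & ? & ? & -> & _).
    exists x, y; auto using op_spec.
  - intros x Hx; destruct (H1 x Hx) as (y & (Hy & Hxy) & U); exists y; split.
    + apply opair_in_iff, Hin; auto.
    + intros y' H; apply opair_in_iff, Hin in H; apply U; tauto.
  - intros y Hy; destruct (H2 y Hy) as (x & (Hx & Hxy) & U); exists x; split.
    + apply opair_in_iff, Hin; auto.
    + intros x' H; apply opair_in_iff, Hin in H; apply U; tauto.
Qed.

Lemma equinumerous_rel X Y : equinumerous X Y -> exists R, Def2 R /\
  (forall x, x ∈ X -> exists! y, y ∈ Y /\ R x y) /\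
  (forall y, y ∈ Y -> exists! x, x ∈ X /\ R x y).
Proof.
  intros (f & [Hf H1] & H2); exists (fun x y => op x y ∈ f).
  assert (K : forall x y, op x y ∈ f -> x ∈ X /\ y ∈ Y).
  { intros x y H; destruct (Hf _ H) as (x' & y' & ? & ? & E).
    apply opair_iff, op_inj in E as [-> ->]; auto. }
  split; [dfn_with ltac:(fail) dfn_op_term | split].
  - intros x Hx; destruct (H1 x Hx) as (y & Hy & U); apply opair_in_iff in Hy.
    exists y; split; [split; auto; eapply K; eauto|].
    intros y' [_ H]; apply U, opair_in_iff, H.
  - intros y Hy; destruct (H2 y Hy) as (x & Hx & U); apply opair_in_iff in Hx.
    exists x; split; [split; auto; eapply K; eauto|].
    intros x' [_ H]; apply U, opair_in_iff, H.
Qed.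

Definition is_adjoin y x a : Prop := ~ a ∈ x /\ forall z, z ∈ y <-> z ∈ x \/ z = a.

Lemma equinumerous_adjoin X Y a k s :
  is_adjoin Y X a -> equinumerous X k -> is_succ s k -> equinumerous Y s.
Proof.
  intros [Ha HY] HX Hs; apply equinumerous_rel in HX as (R & HR & H1 & H2).
  apply equinumerous_of_rel
    with (R := fun x y => (x ∈ X /\ y ∈ k /\ R x y) \/ (x = a /\ y = k)).
  { dfn_with ltac:(fail) dfn_op_term. }
  - intros x Hx; apply HY in Hx as [Hx | ->].
    + destruct (H1 x Hx) as (y & (Hy & Hxy) & U); exists y; split.
      * split; [apply Hs|]; auto.
      * intros y' [_ [(? & ? & ?) | [-> _]]]; [apply U; auto | tauto].
    + exists k; split; [split; [apply Hs|]; auto|].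
      intros y' [_ [(? & _) | [_ ->]]]; tauto.
  - intros y Hy; apply Hs in Hy as [Hy | ->].
    + destruct (H2 y Hy) as (x & (Hx & Hxy) & U); exists x; split.
      * split; [apply HY|]; auto.
      * intros x' [_ [(? & ? & ?) | [_ ->]]]; [apply U; auto | ].
        now apply notin_self in Hy.
    + exists a; split; [split; [apply HY|]; auto|].
      intros x' [_ [(_ & H & _) | [-> _]]]; auto; now apply notin_self in H.
Qed.

Lemma equinumerous_succ Y k s :
  equinumerous Y s -> is_succ s k -> exists X a, is_adjoin Y X a /\ equinumerous X k.
Proof.
  intros HY Hs; apply equinumerous_rel in HY as (R & HR & H1 & H2).
  assert (Hk : k ∈ s) by (apply Hs; auto).
  (* The element to remove is the one matched with the last element [k] of [s]. *)
  destruct (H2 k Hk) as (a & (Ha & Hak) & Ua).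
  destruct (separation (fun x => x <> a) Y) as [X HX];
    [dfn_with ltac:(fail) dfn_op_term|].
  exists X, a; split; [split|].
  - intros H; apply HX in H; tauto.
  - intros z; rewrite (HX z); destruct (classic (z = a)) as [-> |]; tauto.
  - apply equinumerous_of_rel with (R := R); auto.
    + intros x Hx; apply HX in Hx as [Hx Hne].
      destruct (H1 x Hx) as (y & (Hy & Hxy) & U); exists y; split.
      * split; auto; apply Hs in Hy as [Hy | ->]; auto.
        destruct Hne; symmetry; auto.
      * intros y' [H ?]; apply U; split; auto; apply Hs; auto.
    + intros y Hy; assert (Hys : y ∈ s) by (apply Hs; auto).
      destruct (H2 y Hys) as (x & (Hx & Hxy) & U); exists x; split.
      * split; auto; apply HX; split; auto; intros ->.
        destruct (H1 a Ha) as (k' & _ & V).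
        assert (k' = k) by (apply V; auto); assert (k' = y) by (apply V; auto).
        apply (notin_self k); congruence.
      * intros x' [H ?]; apply HX in H as [H _]; apply U; auto.
Qed.

Lemma equinumerous_empty X e : is_empty e -> (equinumerous X e <-> is_empty X).
Proof.
  intros He; split.
  - intros H; apply equinumerous_rel in H as (R & _ & H & _).
    intros x Hx; destruct (H x Hx) as (y & [Hy _] & _); now apply (He y).
  - intros HX; apply equinumerous_of_rel with (R := fun _ _ => False).
    + dfn_with ltac:(fail) dfn_op_term.
    + intros x Hx; now apply HX in Hx.
    + intros x Hx; now apply He in Hx.
Qed.

(** * Induction on the natural numbers and finite sets of the structure *)

Lemma natural_empty e : is_empty e -> is_natural e.
Proof.
  intros He x [(e' & He' & H) _].
  assert (e = e') as -> ; [|exact H].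
  apply extensionality; intros z; split; intros K; [now apply He in K | now apply He' in K].
Qed.

Lemma succ_unique x s t : is_succ s x -> is_succ t x -> s = t.
Proof.
  intros Hs Ht; apply extensionality; intros z; rewrite (Hs z), (Ht z); tauto.
Qed.

Lemma natural_succ k s : is_natural k -> is_succ s k -> is_natural s.
Proof.
  intros Hk Hs x Hx; destruct (proj2 Hx k (Hk x Hx)) as (t & Ht & H).
  rewrite (succ_unique _ _ _ Hs Ht); exact H.
Qed.

(** Separating [P] from an inductive set leaves an inductive set, which contains every natural
    number. Definability of [P] is essential, as the structure may have non-standard numbers. *)
Lemma natural_ind (P : M -> Prop) :
  Def1 P -> (forall e, is_empty e -> P e) ->
  (forall k s, P k -> is_succ s k -> P s) ->
  forall k, is_natural k -> P k.
Proof.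
  intros HP H0 HS k Hk; destruct (zf_infinity M hZF) as [x Hx].
  destruct (separation P x HP) as [y Hy]; apply Hy, Hk; split.
  - destruct Hx as [(e & He & Hex) _]; exists e; split; auto; apply Hy; auto.
  - intros z Hz; apply Hy in Hz as [Hz HPz].
    destruct (proj2 Hx z Hz) as (s & Hs & Hsx); exists s; split; auto.
    apply Hy; split; auto; apply (HS z); auto.
Qed.

Lemma Def2_equinumerous : Def2 (@equinumerous M).
Proof.
  dfn_with ltac:(unfold is_bijection, equinumerous, opair_in, is_function,
    is_opair, is_upair) dfn_op_term.
Qed.

Lemma Def1_finite : Def1 (@finite M).
Proof.
  pose proof Def2_equinumerous.
  dfn_with ltac:(unfold finite, is_natural, inductive, is_empty, is_succ) dfn_op_term.
Qed.

Ltac dfn :=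
  let H := fresh in pose proof Def1_finite as H;
  dfn_with ltac:(unfold subset, is_empty, is_adjoin) dfn_op_term.

Lemma finite_empty X : is_empty X -> finite X.
Proof.
  intros HX; exists X; split; [now apply natural_empty | now apply equinumerous_empty].
Qed.

Lemma finite_adjoin X Y a : is_adjoin Y X a -> finite X -> finite Y.
Proof.
  intros H (k & Hk & E); destruct (succ_exists k) as [s Hs].
  exists s; split; [now apply (natural_succ k) | eapply equinumerous_adjoin; eauto].
Qed.

Lemma finite_ind (P : M -> Prop) :
  Def1 P -> (forall X, is_empty X -> P X) ->
  (forall X Y a, P X -> is_adjoin Y X a -> P Y) ->
  forall X, finite X -> P X.
Proof.
  intros HP H0 HS X (k & Hk & E); revert X E.
  apply (natural_ind (fun k => forall X, equinumerous X k -> P X)); auto.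
  - pose proof Def2_equinumerous; dfn.
  - intros e He X HX; apply H0, (equinumerous_empty X e He), HX.
  - intros j s IH Hs X HX; destruct (equinumerous_succ _ _ _ HX Hs) as (Z & a & Ha & HZ).
    eauto.
Qed.

Lemma finite_insert X Y a :
  (forall z, z ∈ Y <-> z ∈ X \/ z = a) -> finite X -> finite Y.
Proof.
  intros H HX; destruct (classic (a ∈ X)) as [Ha | Ha].
  - assert (Y = X) as ->; auto.
    apply extensionality; intros z; rewrite H; intuition congruence.
  - apply (finite_adjoin X Y a); auto; split; auto.
Qed.

Lemma finite_subset X Y : finite X -> subset Y X -> finite Y.
Proof.
  intros HX; revert Y.
  apply (finite_ind (fun X => forall Y, subset Y X -> finite Y)); auto.
  - dfn.
  - intros Z HZ Y HY; apply finite_empty; intros x Hx; apply (HZ x), HY, Hx.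
  - intros Z W a IH [_ HW] Y HY.
    destruct (separation (fun x => x <> a) Y) as [Y' HY']; [dfn|].
    assert (K : finite Y').
    { apply IH; intros x Hx; apply HY' in Hx as [Hx Hne].
      apply HY, HW in Hx; tauto. }
    destruct (classic (a ∈ Y)) as [Ha | Ha].
    + apply (finite_insert Y' Y a); auto; intros z; rewrite HY'.
      destruct (classic (z = a)) as [-> |]; tauto.
    + assert (Y = Y') as ->; auto; apply extensionality; intros z; rewrite HY'.
      split; [|tauto]; intros Hz; split; auto; congruence.
Qed.

Lemma finite_cup X Y : finite X -> finite Y ->
  exists Z, finite Z /\ forall z, z ∈ X \/ z ∈ Y -> z ∈ Z.
Proof.
  intros HX HY.
  apply (finite_ind (fun X => exists Z, finite Z /\ forall z, z ∈ X \/ z ∈ Y -> z ∈ Z));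
    auto.
  - dfn.
  - intros e He; exists Y; split; auto; intros z [Hz | Hz]; auto; now apply He in Hz.
  - intros W V a (Z & HZ & H) [_ HV]; destruct (adjoin_exists Z a) as [Z' HZ'].
    exists Z'; split; [now apply (finite_insert Z Z' a)|].
    intros z Hz; rewrite HV in Hz; apply HZ'; destruct Hz as [[Hz | ->] | Hz]; auto.
Qed.

(* [P] is an arbitrary predicate of the metatheory: {x | P x} need not be a set. *)
Definition Small (P : M -> Prop) : Prop :=
  exists u, finite u /\ forall x, P x -> x ∈ u.

Lemma Small_finite X : Small (fun x => x ∈ X) <-> finite X.
Proof.
  split; [intros (u & Hu & H); now apply (finite_subset u)|].
  intros H; exists X; auto.
Qed.

Lemma Small_mono (P Q : M -> Prop) : Small P -> (forall x, Q x -> P x) -> Small Q.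
Proof. intros (u & Hu & H) K; exists u; auto. Qed.

Lemma Small_or (P Q : M -> Prop) : Small P -> Small Q -> Small (fun x => P x \/ Q x).
Proof.
  intros (u & Hu & H) (v & Hv & K); destruct (finite_cup u v Hu Hv) as (w & Hw & L).
  exists w; split; auto; intros x [Hx | Hx]; auto.
Qed.

Lemma Small_none (P : M -> Prop) : (forall x, ~ P x) -> Small P.
Proof.
  intros H; destruct empty_exists as [e He]; exists e; split; [now apply finite_empty|].
  intros x Hx; now apply H in Hx.
Qed.

Lemma Small_singleton a : Small (fun x => x = a).
Proof.
  destruct empty_exists as [e He], (adjoin_exists e a) as [u Hu]; exists u; split.
  - apply (finite_insert e u a); auto; now apply finite_empty.
  - intros x ->; apply Hu; auto.
Qed.

Lemma Small_union (Q : M -> Prop) (R : M -> M -> Prop) :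
  Def2 R -> Small Q -> (forall z, Q z -> Small (R z)) ->
  Small (fun y => exists z, Q z /\ R z y).
Proof.
  intros HR (u & Hu & HQ) H.
  (* [Q] may be undefinable, so induction runs over the finite cover [u] instead. Smallness of the
     row [R z] is written into the statement, which keeps it definable and lets points with a large
     row be skipped. *)
  assert (K : Small (fun y => exists z, z ∈ u /\ Small (R z) /\ R z y)).
  { clear Q HQ H; unfold Small.
    apply (finite_ind (fun u => exists v, finite v /\ forall y,
      (exists z, z ∈ u /\ (exists w, finite w /\ forall x, R z x -> x ∈ w) /\ R z y) ->
      y ∈ v)); auto.
    - dfn.
    - intros e He; apply Small_none; intros y (z & Hz & _); now apply He in Hz.
    - intros X Y a IH [_ HY].
      destruct (classic (Small (R a))) as [Ha | Ha].
      + eapply Small_mono; [apply (Small_or _ _ IH Ha)|].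
        intros y (z & Hz & Hs & Hzy); apply HY in Hz as [Hz | ->]; eauto.
      + eapply Small_mono; [apply IH|].
        intros y (z & Hz & Hs & Hzy); apply HY in Hz as [Hz | ->]; [eauto | tauto]. }
  apply (Small_mono _ _ K); intros y (z & Hz & Hzy); exists z; auto.
Qed.

Lemma not_Small_exists (P Q : M -> Prop) :
  ~ Small P -> Small Q -> exists x, P x /\ ~ Q x.
Proof.
  intros HP HQ; apply NNPP; intros H; apply HP, (Small_mono _ _ HQ).
  intros x Hx; apply NNPP; intros K; apply H; eauto.
Qed.

Lemma Small_max (P : M -> Prop) (le : M -> M -> Prop) :
  Def1 P -> Def2 le -> Small P -> (exists x, P x) ->
  (forall x y, P x -> P y -> le x y \/ le y x) ->
  (forall x y z, P x -> P y -> P z -> le x y -> le y z -> le x z) ->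
  exists m, P m /\ forall x, P x -> le x m.
Proof.
  intros HP Hle (u & Hu & HPu) [x0 Hx0] Htot Htrans.
  assert (K : forall u, finite u -> (exists x, x ∈ u /\ P x) ->
    exists m, P m /\ forall x, x ∈ u -> P x -> le x m).
  { apply (finite_ind (fun u => (exists x, x ∈ u /\ P x) ->
      exists m, P m /\ forall x, x ∈ u -> P x -> le x m)).
    - dfn.
    - intros e He (x & Hx & _); now apply He in Hx.
    - intros X Y a IH [_ HY] (b & Hb & HPb); destruct (classic (P a)) as [Ha | Ha].
      + destruct (classic (exists x, x ∈ X /\ P x)) as [K | K].
        * destruct (IH K) as (m & Hm & Hmax).
          destruct (Htot a m Ha Hm) as [L | L]; [exists m | exists a]; split; auto;
            intros x Hx HPx; apply HY in Hx as [Hx | ->]; auto.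
          -- apply (Htrans x m a); auto.
          -- destruct (Htot a a); auto.
        * exists a; split; auto; intros x Hx HPx; apply HY in Hx as [Hx | ->].
          -- destruct K; eauto.
          -- destruct (Htot a a); auto.
      + destruct (classic (exists x, x ∈ X /\ P x)) as [K | K].
        * destruct (IH K) as (m & Hm & Hmax); exists m; split; auto.
          intros x Hx HPx; apply HY in Hx as [Hx | ->]; [auto | tauto].
        * destruct K; apply HY in Hb as [Hb | ->]; [eauto | tauto]. }
  destruct (K u Hu) as (m & Hm & Hmax); eauto.
Qed.

(** For a standard [n] the internal cardinality can be witnessed by a list of the metatheory, so all
    later counting is done on lists. *)
Lemma has_size_list n : forall z, has_size n z <->
  exists l : list M, NoDup l /\ length l = n /\ forall x, x ∈ z <-> In x l.
Proof.
  induction n as [|n IH]; intros z; split.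
  - intros (k & Hk & E); exists nil; split; [constructor|]; split; [reflexivity|].
    intros x; split; [|intros []].
    intros Hx; apply (equinumerous_empty z k Hk) in E; now apply E in Hx.
  - intros ([|a l] & _ & Hl & H); [|discriminate].
    destruct empty_exists as [e He]; exists e; split; [exact He|].
    apply equinumerous_empty; auto; intros x Hx; now apply H in Hx.
  - intros (k & (j & Hj & Hk) & E).
    destruct (equinumerous_succ _ _ _ E Hk) as (X & a & [Ha HX] & HE).
    destruct (proj1 (IH X)) as (l & Hl & Hlen & K); [exists j; auto|].
    exists (a :: l); split; [constructor; auto; rewrite <- K; auto|].
    split; [simpl; auto|]; intros x; rewrite HX, K; simpl; intuition congruence.
  - intros ([|a l] & Hl & Hlen & H); [discriminate|].
    inversion Hl; subst; injection Hlen as Hlen.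
    destruct (separation (fun x => x <> a) z) as [X HX]; [dfn|].
    destruct (proj2 (IH X)) as (j & Hj & HE).
    { exists l; split; [|split]; auto; intros x; rewrite HX, H; simpl.
      split; [intuition congruence|]; intros K; split; auto; congruence. }
    destruct (succ_exists j) as [s Hs]; exists s; split; [exists j; auto|].
    apply (equinumerous_adjoin X z a j s); auto; split.
    + rewrite HX; tauto.
    + intros x; rewrite HX, H; simpl; split.
      * intros [-> | K]; auto; left; split; auto; congruence.
      * intros [[K _] | ->]; auto.
Qed.

(** * Definable selection along a linear order *)

Section Selection.

Context (I : M) (le D : M -> M -> Prop).
Hypotheses (le_def : Def2 le) (D_def : Def2 D).
Hypothesis le_total : forall x y, x ∈ I -> y ∈ I -> le x y \/ le y x.
Hypothesis le_antisym : forall x y, le x y -> le y x -> x = y.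
Hypothesis le_trans : forall x y z, le x y -> le y z -> le x z.
Hypothesis I_infinite : ~ Small (fun x => x ∈ I).
Hypothesis rows : forall z, z ∈ I -> Small (fun w => w ∈ I /\ ~ D z w).
Hypothesis columns : forall w, w ∈ I -> Small (fun z => z ∈ I /\ D z w).

Definition selector (Sig : M -> M -> Prop) : Prop :=
  Def2 Sig /\ (forall z w w', Sig z w -> Sig z w' -> w = w') /\
  forall z, z ∈ I -> exists w, Sig z w /\ D z w.

(** The points with only finitely many points above them: an upper segment of [I] which, if
    infinite, is ordered like the reverse of ω. *)
Let U x : Prop := x ∈ I /\ Small (fun y => y ∈ I /\ ~ le y x).

Lemma U_def : Def1 U.
Proof. unfold U, Small; dfn. Qed.

(** [D z] omits only finitely many points, so it meets the infinite set [U]. As points of [U] have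
    finitely many points above, a greatest common point exists, and it is the selected one. *)
Lemma selector_of_top : ~ Small U -> exists Sig, selector Sig.
Proof.
  intros HU; pose proof U_def.
  exists (fun z w => U w /\ D z w /\ forall w', U w' -> D z w' -> le w' w).
  split; [dfn | split].
  - intros z w w' (H1 & H2 & H3) (K1 & K2 & K3); apply le_antisym; auto.
  - intros z Hz; destruct (not_Small_exists _ _ HU (rows z Hz)) as (w0 & Hw0 & K).
    assert (HD : D z w0) by (apply NNPP; intros H'; apply K; split; auto; apply Hw0).
    (* Restricting to points above [w0] makes the set finite, because [w0] is in [U]. *)
    destruct (Small_max (fun w => U w /\ D z w /\ le w0 w) le) as (m & (H1 & H2 & H3) & Hm);
      auto.
    + dfn.
    + eapply Small_mono; [apply (Small_or _ _ (proj2 Hw0) (Small_singleton w0))|].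
      intros w ([Hw _] & _ & Hle).
      destruct (classic (le w w0)); auto.
    + exists w0; split; [|split]; auto; destruct (le_total w0 w0); auto; apply Hw0.
    + intros x y ([? _] & _) ([? _] & _); auto.
    + eauto.
    + exists m; split; auto; split; [|split]; auto; intros w Hw HDw.
      destruct (le_total w w0) as [L | L]; [apply Hw | apply Hw0 | | auto].
      apply (le_trans _ w0); auto.
Qed.

(* If [U] is finite, there is no greatest element off [U], so the tops, which
   eventually exceed every such point, form a set of order type ω. *)
Let top z x : Prop := (x ∈ I /\ ~ U x /\ ~ D z x) /\
  forall y, y ∈ I -> ~ U y -> ~ D z y -> le y x.

Let J x : Prop := exists z, z ∈ I /\ top z x.

Lemma top_unique z x y : top z x -> top z y -> x = y.
Proof.
  intros [(? & ? & ?) ?] [(? & ? & ?) ?]; apply le_antisym; auto.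
Qed.

(** If [D z y] fails, then [y] is itself an exceptional point of [z] off [U], so the greatest such
    point exists and is at least [y]. By [columns], [D z y] holds for finitely many [z] only. *)
Lemma top_above y : y ∈ I -> ~ U y ->
  Small (fun z => z ∈ I /\ ~ exists x, top z x /\ le y x).
Proof.
  intros Hy HU; apply (Small_mono _ _ (columns y Hy)); intros z [Hz K].
  split; auto; apply NNPP; intros HD; apply K; pose proof U_def.
  destruct (Small_max (fun x => x ∈ I /\ ~ U x /\ ~ D z x) le) as (m & Hm & Hmax).
  - dfn.
  - auto.
  - apply (Small_mono _ _ (rows z Hz)); tauto.
  - eauto.
  - intros a b [Ha _] [Hb _]; auto.
  - eauto.
  - exists m; split; [split; auto|auto].
Qed.

(** Off [U] a point has infinitely many points above it, and a finite [U] cannot contain them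
    all. *)
Lemma above_off_U y : Small U -> y ∈ I -> ~ U y -> exists y', y' ∈ I /\ ~ U y' /\ ~ le y' y.
Proof.
  intros HU Hy HUy.
  assert (H : ~ Small (fun x => x ∈ I /\ ~ le x y)) by (intros H; apply HUy; split; auto).
  destruct (not_Small_exists _ _ H HU) as (x & [? ?] & ?); eauto.
Qed.

(** Take [y'] beyond [y] and off [U]. Almost every [z] has its top at or above [y'], so tops up to
    [y] come from the finitely many remaining [z], each contributing at most one. *)
Lemma J_initial_segment y : Small U -> y ∈ I -> ~ U y -> Small (fun x => J x /\ le x y).
Proof.
  intros HU Hy HUy; destruct (above_off_U y HU Hy HUy) as (y' & Hy' & HUy' & Hn).
  pose proof U_def; eapply Small_mono.
  - apply (Small_union (fun z => z ∈ I /\ ~ exists x, top z x /\ le y' x) top); [unfold top; dfn | apply (top_above y' Hy' HUy') |].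
    intros z _; destruct (classic (exists x, top z x)) as [[x Hx] | Hx].
    + apply (Small_mono _ _ (Small_singleton x)); intros x' Hx'.
      now apply (top_unique z).
    + apply Small_none; intros x Hx'; apply Hx; eauto.
  - intros x [(z & Hz & Hzx) Hle]; exists z; split; auto; split; auto.
    intros (x' & Hx' & Hle'); apply Hn.
    rewrite (top_unique _ _ _ Hx' Hzx) in Hle'; eauto.
Qed.

(** The tops are cofinal in the complement of [U], which has no greatest element. *)
Lemma J_infinite : Small U -> ~ Small J.
Proof.
  intros HU HJ; pose proof U_def.
  assert (cofinal : forall y, y ∈ I -> ~ U y -> exists x, J x /\ le y x).
  { intros y Hy HUy.
    destruct (not_Small_exists _ _ I_infinite (top_above y Hy HUy)) as (z & Hz & K).
    apply NNPP; intros N; apply K; split; auto; intros (x & ? & ?); apply N.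
    exists x; split; auto; exists z; auto. }
  destruct (not_Small_exists _ _ I_infinite HU) as (y & Hy & HUy).
  destruct (Small_max J le) as (m & (z & Hz & [(Hm & HUm & _) _]) & Hmax); auto.
  - unfold J, top; dfn.
  - destruct (cofinal y Hy HUy) as (x & ? & _); eauto.
  - intros a b (za & _ & [[Ha _] _]) (zb & _ & [[Hb _] _]); auto.
  - eauto.
  - destruct (above_off_U m HU Hm HUm) as (y' & Hy' & HUy' & Hn).
    destruct (cofinal y' Hy' HUy') as (x & Hx & Hle); apply Hn; eauto.
Qed.

(** [J] is infinite with finite initial segments, and [D z] omits only finitely many points, so [J]
    has a least element [w] with [D z w]. *)
Lemma selector_of_bottom : Small U -> exists Sig, selector Sig.
Proof.
  intros HU; pose proof U_def.
  assert (J_def : Def1 J) by (unfold J, top; dfn).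
  exists (fun z w => J w /\ D z w /\ forall w', J w' -> D z w' -> le w w').
  split; [dfn | split].
  - intros z w w' (H1 & H2 & H3) (K1 & K2 & K3); apply le_antisym; auto.
  - intros z Hz; destruct (not_Small_exists _ _ (J_infinite HU) (rows z Hz))
      as (w0 & Hw0 & K).
    assert (JI : forall x, J x -> x ∈ I /\ ~ U x)
      by (intros x (y & _ & [(? & ? & _) _]); auto).
    destruct (JI w0 Hw0) as [Hw0I Hw0U].
    assert (HD : D z w0) by (apply NNPP; auto).
    (* A maximum for the reversed order is the required minimum; the bound [w0] makes the set
       finite. *)
    destruct (Small_max (fun w => J w /\ D z w /\ le w w0) (fun x y => le y x))
      as (m & (H1 & H2 & H3) & Hm).
    + dfn.
    + dfn.
    + apply (Small_mono _ _ (J_initial_segment w0 HU Hw0I Hw0U)); tauto.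
    + exists w0; split; [|split]; auto; destruct (le_total w0 w0); auto.
    + intros x y (Hx & _) (Hy & _); apply JI in Hx, Hy.
      destruct (le_total x y); tauto.
    + eauto.
    + exists m; split; auto; split; [|split]; auto; intros w Hw HDw.
      destruct (le_total w w0) as [L | L]; [now apply JI | auto | auto | eauto].
Qed.

Lemma selector_exists : exists Sig, selector Sig.
Proof.
  destruct (classic (Small U)); [now apply selector_of_bottom | now apply selector_of_top].
Qed.

End Selection.

(** * Choice functions *)

Lemma choice_of_definable G (P : M -> M -> Prop) :
  Def2 P -> (forall z, z ∈ G -> exists! x, x ∈ z /\ P z x) -> has_choice_function G.
Proof.
  intros HP H; destruct (zf_union M hZF G) as [V HV], (product_cover G V) as [c Hc].
  destruct (separation (fun p => exists z x, p = op z x /\ z ∈ G /\ x ∈ z /\ P z x) c)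
    as [f Hf]; [dfn|].
  assert (K : forall z x, op z x ∈ f <-> z ∈ G /\ x ∈ z /\ P z x).
  { intros z x; rewrite Hf; split.
    - intros (_ & z' & x' & E & ?); apply op_inj in E as [-> ->]; auto.
    - intros (? & ? & ?); split; [|exists z, x; auto].
      apply Hc; auto; apply HV; eauto. }
  exists f; split.
  - exists V; split; [exact HV|]; split.
    + intros p Hp; apply Hf in Hp as (_ & z & x & -> & Hz & Hx & _).
      exists z, x; split; [|split]; auto using op_spec; apply HV; eauto.
    + intros z Hz; destruct (H z Hz) as (x & [Hx HPx] & Hu); exists x; split.
      * apply opair_in_iff, K; auto.
      * intros y Hy; apply opair_in_iff, K in Hy; apply Hu; tauto.
  - intros z y _ Hy; apply opair_in_iff, K in Hy; tauto.
Qed.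

(** Recasts the choice function as a set of pairs [op s q], so that the chosen point is definable
    with parameter [f]. *)
Lemma ramsey_choice n X : RC n M -> ~ finite X ->
  exists Y f, subset Y X /\ ~ finite Y /\
    forall s, subset s Y -> has_size n s -> exists p, p ∈ s /\ forall q, op s q ∈ f <-> q = p.
Proof.
  intros HRC HX; destruct (HRC X HX) as (Y & HYX & HY & S & HS & f & [(V & HV & _ & Hf) Hch]).
  exists Y, f; split; [|split]; auto.
  intros s HsY Hsize; assert (Hs : s ∈ S) by (apply HS; auto).
  destruct (Hf s Hs) as (p & Hp & Hu); exists p; split; [eauto|].
  intros q; rewrite <- opair_in_iff; split; [symmetry; auto | intros ->; auto].
Qed.

Lemma numeral_natural n : forall k, is_numeral n k -> is_natural k.
Proof.
  induction n as [|n IH]; intros k; [apply natural_empty|].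
  intros (j & Hj & Hk); apply (natural_succ j); auto.
Qed.

Lemma has_size_finite n z : has_size n z -> finite z.
Proof. intros (k & Hk & E); exists k; split; auto; now apply (numeral_natural n). Qed.

Lemma list_partition {T : Type} (P : T -> Prop) (l : list T) : NoDup l ->
  exists l1 l2, NoDup l1 /\ NoDup l2 /\ length l1 + length l2 = length l /\
    (forall t, In t l1 <-> In t l /\ P t) /\ (forall t, In t l2 <-> In t l /\ ~ P t).
Proof.
  induction 1 as [|t l Ha Hl (l1 & l2 & H1 & H2 & Hlen & K1 & K2)].
  - exists nil, nil; repeat split; simpl in *; try constructor; tauto.
  - destruct (classic (P t)) as [Ht | Ht];
      [exists (t :: l1), l2 | exists l1, (t :: l2)];
      (split; [|split; [|split; [|split]]]); simpl; auto.
    + constructor; auto; rewrite K1; tauto.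
    + intros x; rewrite K1; intuition congruence.
    + intros x; rewrite K2; intuition congruence.
    + constructor; auto; rewrite K2; tauto.
    + rewrite Nat.add_succ_r; auto.
    + intros x; rewrite K1; intuition congruence.
    + intros x; rewrite K2; intuition congruence.
Qed.

(** * Indiscernibility in a family without partial choice *)

Section NoChoice.

Context (F : M).
Hypothesis F_size : forall z, z ∈ F -> has_size 5 z.
Hypothesis no_choice : forall P, Def2 P -> Small (fun z => z ∈ F /\ exists! x, x ∈ z /\ P z x).

(** * Homogeneity of splittings into two and three points *)

Section Split.

Context (I : M) (A : M -> M -> Prop).
Hypotheses (I_sub : subset I F) (I_infinite : ~ Small (fun z => z ∈ I)) (A_def : Def2 A).
Hypothesis A_size : forall z, z ∈ I -> exists a1 a2, a1 <> a2 /\ a1 ∈ z /\ a2 ∈ z /\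
  forall x, A z x <-> x = a1 \/ x = a2.

Let B z x : Prop := x ∈ z /\ ~ A z x.

Lemma A_mem z x : z ∈ I -> A z x -> x ∈ z.
Proof.
  intros Hz; destruct (A_size z Hz) as (a1 & a2 & _ & ? & ? & H).
  rewrite H; intros [-> | ->]; auto.
Qed.

Lemma B_size z : z ∈ I -> exists b1 b2 b3, b1 <> b2 /\ b1 <> b3 /\ b2 <> b3 /\
  forall x, B z x <-> x = b1 \/ x = b2 \/ x = b3.
Proof.
  intros Hz; destruct (A_size z Hz) as (a1 & a2 & Ha & Ha1 & Ha2 & HA).
  destruct (proj1 (has_size_list 5 z) (F_size z (I_sub z Hz))) as (l & Hl & Hlen & H).
  destruct (list_partition (A z) l Hl) as (l1 & l2 & H1 & H2 & Hsum & K1 & K2).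
  assert (length l1 = 2).
  { apply Nat.le_antisymm.
    - change 2 with (length (a1 :: a2 :: nil)); apply NoDup_incl_length; auto.
      intros x Hx; apply K1 in Hx as [_ Hx]; apply HA in Hx; simpl; intuition.
    - change 2 with (length (a1 :: a2 :: nil)); apply NoDup_incl_length.
      + repeat constructor; simpl; intuition.
      + intros x Hx; apply K1; rewrite <- H, HA; simpl in Hx.
        destruct Hx as [<- | [<- | []]]; auto. }
  destruct l2 as [|b1 [|b2 [|b3 [|b4 l2]]]]; simpl in Hsum; try (exfalso; congruence).
  - rewrite H0, Hlen in Hsum; discriminate.
  - rewrite H0, Hlen in Hsum; discriminate.
  - rewrite H0, Hlen in Hsum; discriminate.
  - exists b1, b2, b3; inversion_clear H2 as [|? ? N1 N2]; inversion_clear N2 as [|? ? N3 _].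
    simpl in N1, N3; split; [|split; [|split]]; try (intros ->; tauto).
    intros x; unfold B; rewrite H, <- K2; simpl; intuition.
  - rewrite H0, Hlen in Hsum; discriminate.
Qed.

(** A property that is not constant on two points holds for exactly one of them, and so singles out
    a point of z. *)
Lemma A_homogeneous (P : M -> M -> Prop) : Def2 P ->
  Small (fun z => z ∈ I /\ ~ forall x x', A z x -> A z x' -> P z x -> P z x').
Proof.
  intros HP; eapply Small_mono; [apply (no_choice (fun z x => A z x /\ P z x)); dfn|].
  intros z [Hz H]; split; [now apply I_sub|].
  apply NNPP; intros N; apply H; intros x x' Hx Hx' HPx; apply NNPP; intros HPx'.
  apply N; exists x; split; [split; auto; now apply A_mem|].
  intros y (_ & Hy & HPy); destruct (A_size z Hz) as (a1 & a2 & _ & _ & _ & HA).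
  apply HA in Hx, Hx', Hy; intuition congruence.
Qed.

(** A property that is not constant on three points holds for exactly one or fails for exactly one;
    either way a point is singled out. *)
Lemma B_homogeneous (P : M -> M -> Prop) : Def2 P ->
  Small (fun z => z ∈ I /\ ~ forall x x', B z x -> B z x' -> P z x -> P z x').
Proof.
  intros HP; eapply Small_mono; [apply Small_or;
    [apply (no_choice (fun z x => ~ A z x /\ P z x)) |
     apply (no_choice (fun z x => ~ A z x /\ ~ P z x))]; dfn|].
  intros z [Hz H].
  apply NNPP; intros N; apply H; intros x x' Hx Hx' HPx; apply NNPP; intros HPx'.
  assert (K : exists y, B z y /\ P z y /\ y <> x).
  { apply NNPP; intros K; apply N; left; split; [now apply I_sub|].
    exists x; destruct Hx as [Hx HAx]; split; auto.
    intros y (Hy & HAy & HPy); apply NNPP; intros Hne; apply K; exists y.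
    split; [split; auto|auto]. }
  destruct K as (y & Hy & HPy & Hne).
  apply N; right; split; [now apply I_sub|].
  exists x'; split; [destruct Hx'; auto|].
  intros w (Hw & HAw & HPw).
  assert (HBw : B z w) by (split; auto).
  assert (w <> x) by congruence. assert (w <> y) by congruence.
  assert (x <> x') by congruence. assert (y <> x') by congruence.
  destruct (B_size z Hz) as (b1 & b2 & b3 & _ & _ & _ & HB).
  apply HB in Hx, Hx', Hy, HBw; intuition congruence.
Qed.

(* If row and column degrees of a subset of a 2 x 3 grid are constant, say d
   and e, then 2d = 3e, so the subset is empty or full. *)
Lemma AB_homogeneous (R : M -> M -> M -> Prop) : Def3 R ->
  Small (fun z => z ∈ I /\ ~ forall a a' b b',
    A z a -> A z a' -> B z b -> B z b' -> R z a b -> R z a' b').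
Proof.
  intros HR; unfold B; eapply Small_mono; [apply Small_or; [|apply Small_or]|].
  (* The first two properties make the number of neighbours constant over B_z. The third makes it
     constant over A_z whether there are at least two neighbours. *)
  - apply (B_homogeneous (fun z b => exists a, A z a /\ R z a b)); dfn.
  - apply (B_homogeneous (fun z b => forall a, A z a -> R z a b)); dfn.
  - apply (A_homogeneous (fun z a => exists b b', (b ∈ z /\ ~ A z b) /\
      (b' ∈ z /\ ~ A z b') /\ b <> b' /\ R z a b /\ R z a b')); dfn.
  - intros z [Hz N]; apply NNPP; intros H; apply N.
    assert (H1 : forall x x', B z x -> B z x' ->
      (exists a, A z a /\ R z a x) -> exists a, A z a /\ R z a x') by (apply NNPP; tauto).
    assert (H2 : forall x x', B z x -> B z x' ->
      (forall a, A z a -> R z a x) -> forall a, A z a -> R z a x') by (apply NNPP; tauto).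
    assert (H3 : forall a a', A z a -> A z a' ->
      (exists b b', B z b /\ B z b' /\ b <> b' /\ R z a b /\ R z a b') ->
      exists b b', B z b /\ B z b' /\ b <> b' /\ R z a' b /\ R z a' b')
      by (apply NNPP; tauto).
    clear H N; intros a a' b b' Ha Ha' Hb Hb' HRab; apply NNPP; intros N.
    assert (some : forall c, B z c -> exists d, A z d /\ R z d c)
      by (intros c Hc; apply (H1 b c); eauto).
    assert (not_all : forall c, B z c -> ~ forall d, A z d -> R z d c)
      by (intros c Hc Hall; apply N; apply (H2 c b'); auto).
    destruct (A_size z Hz) as (a1 & a2 & Hne & _ & _ & HA).
    destruct (B_size z Hz) as (b1 & b2 & b3 & N1 & N2 & N3 & HB).
    assert (A1 : A z a1) by (apply HA; auto). assert (A2 : A z a2) by (apply HA; auto).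
    assert (B1 : B z b1) by (apply HB; auto). assert (B2 : B z b2) by (apply HB; auto).
    assert (B3 : B z b3) by (apply HB; auto).
    (* Every point of B_z has exactly one neighbour, so three edges are shared by two points of A_z.
       Exactly one of these then has two or more edges, against [H3]. *)
    assert (one : forall c, B z c -> (R z a1 c <-> ~ R z a2 c)).
    { intros c Hc; split.
      - intros K1 K2; apply (not_all c Hc); intros d Hd.
        apply HA in Hd as [-> | ->]; auto.
      - intros K; destruct (some c Hc) as (d & Hd & HRd).
        apply HA in Hd as [-> | ->]; tauto. }
    assert (two : forall d, A z d ->
      ((exists c c', B z c /\ B z c' /\ c <> c' /\ R z d c /\ R z d c') <->
      (R z d b1 /\ R z d b2) \/ (R z d b1 /\ R z d b3) \/ (R z d b2 /\ R z d b3))).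
    { intros d Hd; split.
      - intros (c & c' & Hc & Hc' & Hcc & K & K'); apply HB in Hc, Hc'.
        destruct Hc as [-> | [-> | ->]], Hc' as [-> | [-> | ->]]; tauto.
      - intros [[? ?] | [[? ?] | [? ?]]];
          [exists b1, b2 | exists b1, b3 | exists b2, b3]; auto. }
    pose proof (H3 a1 a2 A1 A2) as T1; pose proof (H3 a2 a1 A2 A1) as T2.
    rewrite (two a1 A1), (two a2 A2) in T1; rewrite (two a1 A1), (two a2 A2) in T2.
    pose proof (one b1 B1) as O1; pose proof (one b2 B2) as O2; pose proof (one b3 B3) as O3.
    clear - T1 T2 O1 O2 O3; rewrite O1, O2, O3 in T1, T2.
    destruct (classic (R z a2 b1)), (classic (R z a2 b2)), (classic (R z a2 b3)); tauto.
Qed.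

(** * Choices from crosses of two full grids *)

Section Full.

Context (Y f r : M).
Hypothesis Y_full : forall z a b, z ∈ I -> A z a -> B z b -> op z (op a b) ∈ Y.
Hypothesis f_choice : forall s, subset s Y -> has_size 5 s ->
  exists p, p ∈ s /\ forall q, op s q ∈ f <-> q = p.
Hypothesis r_order : is_linear_order r F.

(* The chosen element of the 5-element set [{z} × {a} × B_z ∪ {w} × A_w × {b}]. *)
Let chosen z w a b p : Prop := exists s, op s p ∈ f /\ forall q, q ∈ s <->
  (exists b', B z b' /\ q = op z (op a b')) \/ (exists a', A w a' /\ q = op w (op a' b)).

(** The two pieces are disjoint because their first coordinates z and w differ, so the set has 3 + 2
    = 5 points and [f] chooses from it. *)
Lemma chosen_exists z w a b : z ∈ I -> w ∈ I -> w <> z -> A z a -> B w b ->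
  exists p, (forall q, chosen z w a b q <-> q = p) /\
    ((exists b', B z b' /\ p = op z (op a b')) \/ (exists a', A w a' /\ p = op w (op a' b))).
Proof.
  intros Hz Hw Hne Ha Hb.
  destruct (separation (fun q => (exists b', B z b' /\ q = op z (op a b')) \/
    (exists a', A w a' /\ q = op w (op a' b))) Y) as [s Hs]; [unfold B; dfn|].
  assert (K : forall q, q ∈ s <-> (exists b', B z b' /\ q = op z (op a b')) \/
    (exists a', A w a' /\ q = op w (op a' b))).
  { intros q; rewrite Hs; split; [tauto|]; intros H; split; auto.
    destruct H as [(b' & Hb' & ->) | (a' & Ha' & ->)]; auto. }
  destruct (f_choice s) as (p & Hp & Hf).
  - intros q Hq; now apply Hs in Hq.
  - apply has_size_list; destruct (B_size z Hz) as (b1 & b2 & b3 & N1 & N2 & N3 & HB).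
    destruct (A_size w Hw) as (a1 & a2 & Na & _ & _ & HA).
    exists (op z (op a b1) :: op z (op a b2) :: op z (op a b3) ::
      op w (op a1 b) :: op w (op a2 b) :: nil); split; [|split; [reflexivity|]].
    + assert (E1 : forall c c', op z (op a c) = op z (op a c') -> c = c')
        by (intros c c' E; apply op_inj in E as [_ E]; now apply op_inj in E).
      assert (E2 : forall c c', op w (op c b) = op w (op c' b) -> c = c')
        by (intros c c' E; apply op_inj in E as [_ E]; now apply op_inj in E).
      assert (E3 : forall c d, op w c <> op z d)
        by (intros c d E; apply op_inj in E; tauto).
      repeat constructor; simpl; intros H;
        repeat match goal with
        | H : _ \/ _ |- _ => destruct H as [H | H]
        | H : op z _ = op z _ |- _ => apply E1 in H
        | H : op w (op _ b) = op w _ |- _ => apply E2 in H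
        | H : op w _ = op z _ |- _ => apply E3 in H
        end; try congruence; try tauto.
    + intros q; rewrite K; split.
      * intros [(b' & Hb' & ->) | (a' & Ha' & ->)];
          [apply HB in Hb' as [-> | [-> | ->]] | apply HA in Ha' as [-> | ->]]; simpl; tauto.
      * simpl; intros [<- | [<- | [<- | [<- | [<- | []]]]]].
        -- left; exists b1; split; auto; apply HB; auto.
        -- left; exists b2; split; auto; apply HB; auto.
        -- left; exists b3; split; auto; apply HB; auto.
        -- right; exists a1; split; auto; apply HA; auto.
        -- right; exists a2; split; auto; apply HA; auto.
  - exists p; split; [|now apply K].
    intros q; split.
    + intros (s' & Hs' & K'); assert (s' = s) as ->; [|now apply Hf].
      apply extensionality; intros x; rewrite K, K'; reflexivity.
    + intros ->; exists s; split; [now apply Hf | exact K].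
Qed.

(** The graph of h for the pair z, w: the choice falls into the piece over z and has last coordinate
    [b'] = h(a), whatever b is. *)
Let stable z w a b' : Prop := forall b, B w b -> chosen z w a b (op z (op a b')).

Let D z w : Prop := w ∈ I /\ w <> z /\ forall a, A z a -> exists b', B z b' /\ stable z w a b'.

Lemma D_def : Def2 D.
Proof. unfold D, stable, chosen, B; dfn. Qed.

Lemma stable_unique z w a b b' : D z w -> z ∈ I -> A z a ->
  stable z w a b -> stable z w a b' -> b = b'.
Proof.
  intros (Hw & Hne & _) Hz Ha H H'.
  destruct (B_size w Hw) as (c & ? & ? & _ & _ & _ & HB).
  assert (Hc : B w c) by (apply HB; auto).
  destruct (chosen_exists z w a c) as (p & Hp & _); auto.
  specialize (H c Hc); specialize (H' c Hc); apply Hp in H, H'.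
  rewrite <- H' in H; apply op_inj in H as [_ H]; now apply op_inj in H.
Qed.

(** Let w vary with z and a fixed. A choice inside the piece over w would, by homogeneity of A_w ×
    B_w, fall on both points of A_w at once. A choice inside the piece over z is independent of b by
    homogeneity of B_w. *)
Lemma D_cofinite z : z ∈ I -> Small (fun w => w ∈ I /\ ~ D z w).
Proof.
  intros Hz; destruct (B_size z Hz) as (b1 & b2 & b3 & _ & _ & _ & HB).
  assert (stable_ex : forall a, A z a ->
    Small (fun w => w ∈ I /\ w <> z /\ ~ exists b', B z b' /\ stable z w a b')).
  { intros a Ha; eapply Small_mono; [apply Small_or;
      (* The three points of B_z enter as parameters, with one property of B_w for each. *)
      [apply (AB_homogeneous (fun w a' b => chosen z w a b (op w (op a' b)))) | apply Small_or;
      [apply (B_homogeneous (fun w b => chosen z w a b (op z (op a b1)))) | apply Small_or;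
      [apply (B_homogeneous (fun w b => chosen z w a b (op z (op a b2)))) |
       apply (B_homogeneous (fun w b => chosen z w a b (op z (op a b3))))]]];
      unfold chosen, B; dfn|].
    intros w (Hw & Hne & N); apply NNPP; intros H; apply N.
    destruct (B_size w Hw) as (c & ? & ? & _ & _ & _ & HBw).
    assert (Hc : B w c) by (apply HBw; auto).
    destruct (chosen_exists z w a c) as (p & Hp & [(b' & Hb' & ->) | (a' & Ha' & ->)]); auto.
    - exists b'; split; auto; intros b Hb.
      assert (Hcb : chosen z w a c (op z (op a b'))) by (apply Hp; reflexivity).
      apply NNPP; intros K; apply H; apply HB in Hb' as [-> | [-> | ->]];
        [right; left | do 2 right; left | do 3 right]; split; auto.
      all: intros L; apply K, (L c b); auto.
    - exfalso; destruct (A_size w Hw) as (a1 & a2 & Na & _ & _ & HA).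
      assert (K : forall a'', A w a'' -> a'' = a').
      { intros a'' Ha''.
        assert (chosen z w a c (op w (op a'' c))) as K.
        { apply NNPP; intros K; apply H; left; split; auto; intros L.
          apply K, (L a' a'' c c); auto; apply Hp; reflexivity. }
        apply Hp, op_inj in K as [_ K]; now apply op_inj in K. }
      apply Na; rewrite (K a1), (K a2); auto; apply HA; auto. }
  destruct (A_size z Hz) as (a1 & a2 & _ & _ & _ & HA).
  assert (A1 : A z a1) by (apply HA; auto). assert (A2 : A z a2) by (apply HA; auto).
  eapply Small_mono; [apply (Small_or _ _ (Small_singleton z)
    (Small_or _ _ (stable_ex a1 A1) (stable_ex a2 A2)))|].
  intros w [Hw N]; apply NNPP; intros H; apply N; split; auto; split; [tauto|].
  intros a Ha; apply HA in Ha as [-> | ->]; apply NNPP; tauto.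
Qed.

(* For [D z w] the relation [stable z w] is the graph of a function A_z -> B_z,
   which is neither empty nor full. *)
Lemma D_not_selectable (Sig : M -> M -> Prop) : Def2 Sig ->
  (forall z w w', Sig z w -> Sig z w' -> w = w') ->
  Small (fun z => z ∈ I /\ exists w, Sig z w /\ D z w).
Proof.
  intros HSig Hfun; eapply Small_mono;
    [apply (AB_homogeneous (fun z a b => exists w, Sig z w /\ stable z w a b));
     unfold stable, chosen, B; dfn|].
  intros z (Hz & w & Hzw & HD); split; auto; intros H.
  destruct (A_size z Hz) as (a & ? & _ & _ & _ & HA).
  assert (Ha : A z a) by (apply HA; auto).
  destruct (proj2 (proj2 HD) a Ha) as (b & Hb & Hst).
  (* Homogeneity would relate [a] to all of B_z, whereas h(a) is a single point. *)
  assert (K : forall b', B z b' -> b' = b).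
  { intros b' Hb'; destruct (H a a b b') as (w' & Hw' & Hst'); eauto.
    rewrite (Hfun z w' w) in Hst'; auto.
    now apply (stable_unique z w a). }
  destruct (B_size z Hz) as (b1 & b2 & ? & Nb & _ & _ & HB).
  apply Nb; rewrite (K b1), (K b2); auto; apply HB; auto.
Qed.

Lemma no_full_split : False.
Proof.
  destruct r_order as (_ & Htot & Hanti & Htrans); pose proof D_def.
  destruct (selector_exists I (fun x y => op x y ∈ r) D) as (Sig & HSig & Hfun & Hex).
  - dfn.
  - auto.
  - intros x y Hx Hy; rewrite <- !opair_in_iff; auto.
  - intros x y; rewrite <- !opair_in_iff; auto.
  - intros x y z; rewrite <- !opair_in_iff; eauto.
  - exact I_infinite.
  - exact D_cofinite.
  (* An infinite column would make the constant map with value [w] a definable selection. *)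
  - intros w Hw; apply (Small_mono _ _ (D_not_selectable (fun z w' => w' = w)
      ltac:(dfn) ltac:(congruence))).
    intros z [Hz HD]; eauto.
  - apply I_infinite, (Small_mono _ _ (D_not_selectable Sig HSig Hfun)).
    intros z Hz; auto.
Qed.

End Full.

End Split.

(** * Splittings and full grids from RC_5 *)

(** [R] is a partial map on [X] whose values cover [I], so a finite [X] would make [I] finite. *)
Lemma tagged_infinite I X (R : M -> M -> Prop) :
  Def2 R -> ~ Small (fun z => z ∈ I) ->
  (forall z, z ∈ I -> exists p, p ∈ X /\ R p z) ->
  (forall p z z', R p z -> R p z' -> z = z') -> ~ finite X.
Proof.
  intros HR HI Hex Hfun HX; apply HI.
  eapply Small_mono; [apply (Small_union (fun p => p ∈ X) R HR)|].
  - now apply Small_finite.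
  - intros p _; destruct (classic (exists z, R p z)) as [[z Hz] | N].
    + apply (Small_mono _ _ (Small_singleton z)); eauto.
    + apply Small_none; intros z Hz; apply N; eauto.
  - auto.
Qed.

Lemma Small_image X (t : M -> M) :
  Def2 (fun x y => y = t x) -> finite X -> Small (fun y => exists x, x ∈ X /\ y = t x).
Proof.
  intros Ht HX; apply (Small_union (fun x => x ∈ X) (fun x y => y = t x) Ht).
  - now apply Small_finite.
  - intros x _; apply Small_singleton.
Qed.

Hypothesis F_infinite : ~ Small (fun z => z ∈ F).
Hypothesis RC5 : RC 5 M.

Definition is_split I (A : M -> M -> Prop) : Prop :=
  subset I F /\ ~ Small (fun z => z ∈ I) /\ Def2 A /\
  forall z, z ∈ I -> exists a1 a2, a1 <> a2 /\ a1 ∈ z /\ a2 ∈ z /\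
    forall x, A z x <-> x = a1 \/ x = a2.

(** Identify z with its copy in the disjoint union of [F]. Traces of [Y] of size 1 or 4 single out a
    point of z, and for size 5 the choice function does. Hence almost every nonempty trace has size
    2 or 3. *)
Lemma split_exists : exists I A, is_split I A.
Proof.
  destruct (zf_union M hZF F) as [V HV], (product_cover V F) as [c Hc].
  destruct (separation (fun p => exists x z, p = op x z /\ z ∈ F /\ x ∈ z) c) as [X HX];
    [dfn|].
  assert (HXin : forall x z, z ∈ F -> x ∈ z -> op x z ∈ X).
  { intros x z Hz Hx; apply HX; split; [apply Hc; auto; apply HV; eauto|].
    exists x, z; auto. }
  destruct (ramsey_choice 5 X RC5) as (Y & f & HYX & HY & Hf).
  { apply (tagged_infinite F X (fun p z => exists x, p = op x z)); auto; [dfn| |].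
    - intros z Hz; destruct (proj1 (has_size_list 5 z) (F_size z Hz))
        as ([|x l] & _ & Hl & K); [discriminate|].
      assert (Hx : x ∈ z) by (apply K; simpl; auto).
      exists (op x z); eauto.
    - intros p z z' [x ->] [x' E]; now apply op_inj in E. }
  pose (two := fun z => exists x1 x2, x1 <> x2 /\ x1 ∈ z /\ x2 ∈ z /\
    forall x, x ∈ z -> (op x z ∈ Y <-> x = x1 \/ x = x2)).
  (* A trace of size 3 is expressed by exactly two points of z being left out. *)
  pose (three := fun z => exists x1 x2, x1 <> x2 /\ x1 ∈ z /\ x2 ∈ z /\
    forall x, x ∈ z -> (~ op x z ∈ Y <-> x = x1 \/ x = x2)).
  destruct (separation (fun z => two z \/ three z) F) as [I HI]; [unfold two, three; dfn|].
  (* A_z is the trace of [Y] or its complement in z, whichever has two points. *)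
  exists I, (fun z x => x ∈ z /\ ((two z /\ op x z ∈ Y) \/ (~ two z /\ ~ op x z ∈ Y))).
  split; [intros z Hz; now apply HI in Hz|]; split; [|split].
  2: { unfold two; dfn. }
  2: { intros z Hz; apply HI in Hz as [Hz Hor]; destruct (classic (two z)) as [T | T].
       - destruct T as (x1 & x2 & Hne & H1 & H2 & K); exists x1, x2.
         split; [|split; [|split]]; auto; intros x; split.
         + intros [Hx [[_ L] | [L _]]]; [now apply K | exfalso; apply L].
           exists x1, x2; auto.
         + intros L; assert (Hx : x ∈ z) by (destruct L as [-> | ->]; auto).
           split; auto; left; split; [exists x1, x2; auto | now apply K].
       - destruct Hor as [Hor | (x1 & x2 & Hne & H1 & H2 & K)]; [tauto|].
         exists x1, x2; split; [|split; [|split]]; auto; intros x; split.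
         + intros [Hx [[L _] | [_ L]]]; [tauto | now apply K].
         + intros L; assert (Hx : x ∈ z) by (destruct L as [-> | ->]; auto).
           split; auto; right; split; [auto | now apply K]. }
  intros HIs; apply HY.
  (* If [I] were finite, only finitely many z would meet [Y], and [Y] would be finite. *)
  assert (Hmeet : Small (fun z => z ∈ F /\ exists x, x ∈ z /\ op x z ∈ Y)).
  { eapply Small_mono; [apply Small_or; [exact HIs | apply Small_or;
      [apply (no_choice (fun z x => op x z ∈ Y)) | apply Small_or;
      [apply (no_choice (fun z x => ~ op x z ∈ Y)) |
       apply (no_choice (fun z x => exists s, op s (op x z) ∈ f /\
         forall p, p ∈ s <-> exists y, y ∈ z /\ p = op y z))]]]; dfn|].
    intros z (Hz & x0 & Hx0 & Hx0Y).
    destruct (proj1 (has_size_list 5 z) (F_size z Hz)) as (l & Hl & Hlen & H).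
    destruct (list_partition (fun x => op x z ∈ Y) l Hl)
      as (l1 & l2 & N1 & N2 & Hsum & K1 & K2).
    assert (In x0 l1) as Hin by (apply K1; split; [now apply H | auto]).
    rewrite Hlen in Hsum.
    destruct l1 as [|x1 [|x2 [|x3 [|x4 [|x5 [|x6 l1]]]]]]; [destruct Hin | | | | | |];
      simpl in Hsum; injection Hsum as Hsum.
    - right; left; split; auto; exists x1; split.
      + split; [apply H|]; apply K1; simpl; auto.
      + intros x [Hx HxY].
        assert (In x (x1 :: nil)) as [-> | []] by (apply K1; split; [now apply H | auto]).
        reflexivity.
    - left; apply HI; split; auto; left; exists x1, x2.
      inversion_clear N1 as [|? ? Hnin _].
      split; [intros ->; apply Hnin; simpl; auto|].
      split; [apply H, K1; simpl; auto|]; split; [apply H, K1; simpl; auto|].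
      intros x Hx; split.
      + intros HxY; assert (In x (x1 :: x2 :: nil)) as [-> | [-> | []]]; auto.
        apply K1; split; [now apply H | auto].
      + intros [-> | ->]; apply (K1 _); simpl; auto.
    - left; apply HI; split; auto; right.
      destruct l2 as [|y1 [|y2 [|y3 l2]]]; simpl in Hsum; try discriminate.
      exists y1, y2.
      inversion_clear N2 as [|? ? Hnin _].
      split; [intros ->; apply Hnin; simpl; auto|].
      split; [apply H, K2; simpl; auto|]; split; [apply H, K2; simpl; auto|].
      intros x Hx; split.
      + intros HxY; assert (In x (y1 :: y2 :: nil)) as [-> | [-> | []]]; auto.
        apply K2; split; [now apply H | auto].
      + intros [-> | ->]; apply (K2 _); simpl; auto.
    - do 2 right; left; split; auto.
      destruct l2 as [|y1 [|y2 l2]]; simpl in Hsum; try discriminate.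
      exists y1; split.
      + split; [apply H|]; apply K2; simpl; auto.
      + intros x [Hx HxY].
        assert (In x (y1 :: nil)) as [-> | []] by (apply K2; split; [now apply H | auto]).
        reflexivity.
    - do 3 right; split; auto.
      destruct l2 as [|y1 l2]; simpl in Hsum; try discriminate.
      assert (Hall : forall x, x ∈ z -> op x z ∈ Y).
      { intros x Hx; apply NNPP; intros HxY.
        assert (In x nil) as [] by (apply K2; split; [now apply H | auto]). }
      destruct (separation (fun p => exists y, y ∈ z /\ p = op y z) Y) as [s Hs]; [dfn|].
      assert (Hs' : forall p, p ∈ s <-> exists y, y ∈ z /\ p = op y z).
      { intros p; rewrite Hs; split; [tauto|].
        intros (y & Hy & ->); split; auto; exists y; auto. }
      destruct (Hf s) as (p & Hp & Hu).
      + intros p Hp; now apply Hs in Hp.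
      + apply has_size_list; exists (map (fun y => op y z) l); split; [|split].
        * apply NoDup_map_NoDup_ForallPairs; auto.
          intros a b _ _ E; now apply op_inj in E.
        * now rewrite length_map.
        * intros p; rewrite Hs', in_map_iff; split.
          -- intros (y & Hy & ->); exists y; split; auto; now apply H.
          -- intros (y & <- & Hy); exists y; split; auto; now apply H.
      + destruct (proj1 (Hs' p) Hp) as (y & Hy & ->); exists y; split.
        * split; auto; exists s; split; [now apply Hu | exact Hs'].
        * intros x (_ & s' & Hx & Hs''); assert (s' = s) as ->.
          { apply extensionality; intros q; rewrite Hs', Hs''; reflexivity. }
          apply Hu, op_inj in Hx; symmetry; tauto.
    - discriminate. }
  apply Small_finite; eapply Small_mono;
    [apply (Small_union _ (fun z p => exists x, x ∈ z /\ p = op x z)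
      ltac:(dfn) Hmeet)|].
  - intros z [Hz _]; apply Small_image; [dfn | apply (has_size_finite 5), F_size, Hz].
  - intros p Hp; destruct (proj1 (HX p) (HYX p Hp)) as (_ & x & z & -> & Hz & Hx).
    exists z; split; [split; auto; exists x; auto | exists x; auto].
Qed.

(** RC_5 is applied to the disjoint union of the grids A_z × B_z. By homogeneity almost every grid
    that meets [Y] lies inside [Y]; as [Y] is infinite, there are infinitely many such grids, and
    [no_full_split] applies to them. *)
Lemma not_linearly_ordered r : ~ is_linear_order r F.
Proof.
  intros Hr; destruct split_exists as (I & A & HIF & HI & HA & HA2).
  destruct (zf_union M hZF F) as [V HV], (product_cover V V) as [c Hc].
  destruct (product_cover F c) as [d Hd].
  destruct (separation (fun p => exists z a b, p = op z (op a b) /\ z ∈ I /\ A z a /\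
    b ∈ z /\ ~ A z b) d) as [X HX]; [dfn|].
  assert (HXin : forall z a b, z ∈ I -> A z a -> b ∈ z -> ~ A z b -> op z (op a b) ∈ X).
  { intros z a b Hz Ha Hb Hnb; apply HX; split; [|exists z, a, b; auto].
    apply Hd; [auto | apply Hc; apply HV; exists z; split; auto].
    now apply (A_mem I A HA2). }
  destruct (ramsey_choice 5 X RC5) as (Y & f & HYX & HY & Hf).
  { apply (tagged_infinite I X (fun p z => exists q, p = op z q)); auto; [dfn| |].
    - intros z Hz; destruct (HA2 z Hz) as (a & ? & _ & _ & _ & Ha).
      destruct (B_size I A HIF HA2 z Hz) as (b & ? & ? & _ & _ & _ & Hb).
      assert (HBb : b ∈ z /\ ~ A z b) by (apply Hb; auto).
      assert (HAa : A z a) by (apply Ha; auto).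
      exists (op z (op a b)); split; [apply HXin; tauto | eauto].
    - intros p z z' [x ->] [x' E]; now apply op_inj in E. }
  destruct (separation (fun z => forall a b, A z a -> b ∈ z -> ~ A z b ->
    op z (op a b) ∈ Y) I) as [I' HI']; [dfn|].
  apply (no_full_split I' A) with (Y := Y) (f := f) (r := r); auto.
  - intros z Hz; apply HI' in Hz as [Hz _]; auto.
  - intros HIs; apply HY, Small_finite.
    assert (Hmeet : Small (fun z => z ∈ I /\ exists a b, A z a /\ (b ∈ z /\ ~ A z b) /\
      op z (op a b) ∈ Y)).
    { eapply Small_mono; [apply Small_or; [exact HIs |
        apply (AB_homogeneous I A HIF HA HA2 (fun z a b => op z (op a b) ∈ Y)); dfn]|].
      intros z (Hz & a & b & Ha & Hb & HYab).
      apply NNPP; intros N; apply N; right; split; auto; intros K; apply N; left.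
      apply HI'; split; auto; intros a' b' Ha' Hb' Hnb'; apply (K a a' b b'); auto. }
    eapply Small_mono; [apply (Small_union _ (fun z p => exists a, a ∈ z /\
      exists b, b ∈ z /\ p = op z (op a b)) ltac:(dfn) Hmeet)|].
    + intros z [Hz _].
      assert (Hfin : finite z) by (apply (has_size_finite 5), F_size, HIF, Hz).
      apply (Small_union (fun a => a ∈ z) (fun a p => exists b, b ∈ z /\ p = op z (op a b)));
        [dfn | now apply Small_finite |].
      intros a _; apply Small_image; [dfn | exact Hfin].
    + intros p Hp; destruct (proj1 (HX p) (HYX p Hp)) as (_ & z & a & b & -> & Hz & Ha & Hb & Hnb).
      exists z; split; [split; auto; exists a, b; auto|].
      exists a; split; [now apply (A_mem I A HA2) | exists b; auto].
  - intros z Hz; apply HI' in Hz as [Hz _]; auto.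
  - intros z a b Hz Ha [Hb Hnb]; apply HI' in Hz as [_ Hz]; auto.
Qed.

End NoChoice.

End Model.

(** * Conclusion by contradiction *)

Theorem theorem4p1 (M : set_structure) (hZF : ZF M) (hRC : RC 5 M) :
  LOC_minus 5 M.
Proof.
  intros F HF [r Hr] Hsize; apply NNPP; intros H.
  apply (not_linearly_ordered hZF F Hsize) with (r := r); auto.
  (* The z in which [P] singles out one point form a set with a choice function; were it infinite,
     it would be the subfamily excluded by [H]. *)
  - intros P HP.
    destruct (separation hZF (fun z => exists! x, x ∈ z /\ P z x) F) as [G HG];
      [dfn_with ltac:(fail) dfn_term|].
    apply NNPP; intros HS; apply H; exists G; split; [|split].
    + intros z Hz; now apply HG in Hz.
    + intros Hfin; apply HS; exists G; split; [exact Hfin | intros z Hz; now apply HG].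
    + apply (choice_of_definable hZF G P HP); intros z Hz; now apply HG in Hz.
  - intros K; apply HF, (Small_finite hZF), K.
Qed.
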